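(* Let $K$ be a field of characteristic zero, let $f,g\in K[x]$ with $f(x)=x^d+c$ for some $d\geq2$ and $c\in K$, and assume $g$ is monic and irreducible in $K[x]$. If $g\circ f$ is reducible in $K[x]$, then \[ g(f(0))=(-1)^{e_1}4^{e_2}y^m \] for some $e_1,e_2\in\{0,1\}$, some $y\in K$, and some divisor $m\geq2$ of $d$. *)

(* Defs.v *)
From HB Require Import structures.
From mathcomp Require Export all_boot all_order all_algebra.

(* Main.v *)
Require Import Defs.
From mathcomp Require Import all_boot all_order all_algebra.
From Stdlib Require Import Classical.
Set Implicit Arguments.
Unset Strict Implicit.
Unset Printing Implicit Defensive.
Import GRing.Theory.
Local Open Scope ring_scope.

(** Translating by [c], we may assume [f = 'X^d].  It then suffices to show that
    if [p] is prime and [g \Po 'X^p] is reducible then [g(0)] is, up to sign, a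
    [p]-th power: [g \Po 'X^p] has the same constant term as [g], so one can
    strip the prime factors of [d] one at a time.  Let [h] be a proper monic
    factor of [g \Po 'X^p], with companion matrix [C].  Then [g] kills [C ^+ p],
    so the characteristic polynomial of [C ^+ p] is a power [g ^+ k] of the
    irreducible [g], where [0 < k < p] by comparing degrees.  The constant terms
    give [g(0)^k = +- h(0)^p], and [k] is invertible modulo [p].  *)

Lemma monic_dvdp_irredX (K : fieldType) (g q : {poly K}) (n : nat) :
  g \is monic -> irreducible_poly g -> q \is monic -> q %| g ^+ n ->
  exists k, q = g ^+ k.
Proof.
move=> g_monic g_irr; elim: n q => [|n IHn] q q_monic.
  rewrite expr0 dvdp1 size_poly_eq1 eqp_monic ?monic1 // => /eqP ->.
  by exists 0%N; rewrite expr0.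
have [g_dvd_q|g_ndvd_q] := boolP (g %| q); last first.
  rewrite exprS Gauss_dvdpr; first exact: IHn.
  by rewrite coprimep_sym irreducible_poly_coprime.
rewrite -(divpK g_dvd_q) exprSr dvdp_mul2r ?irredp_neq0 // => q'_dvd.
have q'_monic : q %/ g \is monic by rewrite -(monicMr _ g_monic) divpK.
by have [k ->] := IHn _ q'_monic q'_dvd; exists k.+1; rewrite exprSr.
Qed.

(** This is the factor theorem over matrices: ['X - A] divides [g - g(A)] on the left. The quotient
    is built Horner-style from [(q 'X + c) - (A q(A) + c) = ('X - A) q + A (q - q(A))], using that
    [A] commutes with ['X - A]. *)
Lemma char_poly_mx_factor (R : comNzRingType) (n : nat) (A : 'M[R]_n.+1)
    (g : {poly R}) :
  exists Q, g%:M - map_mx polyC (horner_mx A g) = char_poly_mx A *m Q.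
Proof.
elim/poly_ind: g => [|q c [Q IHq]].
  by exists 0; rewrite mulmx0 !rmorph0 subr0.
exists (q%:M + map_mx polyC A *m Q).
rewrite mulmxDr mulmxA.
have -> : char_poly_mx A *m map_mx polyC A = map_mx polyC A *m char_poly_mx A.
  by rewrite /char_poly_mx mulmxBl mulmxBr scalar_mxC.
have -> : horner_mx A (q * 'X + c%:P) = A *m horner_mx A q + c%:M.
  rewrite rmorphD rmorphM /= horner_mx_X horner_mx_C.
  by rewrite -mulmxE (comm_horner_mx _ (comm_mx_refl A)).
rewrite -mulmxA -IHq map_mxD map_scalar_mx map_mxM raddfD /= opprD addrACA.
by rewrite subrr addr0 mulmxBr mulmxBl -scalar_mxM (mulrC q) addrA addrNK.
Qed.

(** When [g(A) = 0] the factorisation reads [g%:M = ('X - A) Q]; take determinants. *)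
Lemma char_poly_dvdX (K : fieldType) (n : nat) (A : 'M[K]_n.+1) (g : {poly K}) :
  horner_mx A g = 0 -> char_poly A %| g ^+ n.+1.
Proof.
move=> gA0; have [Q] := char_poly_mx_factor A g.
rewrite gA0 map_mx0 subr0 => /(congr1 determinant).
by rewrite det_scalar det_mulmx => ->; rewrite dvdp_mulr.
Qed.

Lemma horner_mx_comp (R : comNzRingType) (n : nat) (A : 'M[R]_n.+1)
    (p q : {poly R}) :
  horner_mx A (p \Po q) = horner_mx (horner_mx A q) p.
Proof.
elim/poly_ind: p => [|p c IHp]; first by rewrite comp_poly0 !raddf0.
by rewrite comp_polyD comp_polyM comp_polyX comp_polyC !rmorphD !rmorphM /=
           IHp horner_mx_X !horner_mx_C.
Qed.

Lemma det_exp (R : comNzRingType) (n p : nat) (A : 'M[R]_n.+1) :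
  \det (A ^+ p) = \det A ^+ p.
Proof. by elim: p => [|p IHp]; rewrite ?det1 // !exprS -IHp det_mulmx. Qed.

Lemma monic_dvdp_comp_Xn (K : fieldType) (g h : {poly K}) (p : nat) :
  g \is monic -> irreducible_poly g ->
  h \is monic -> (1 < size h)%N -> h %| g \Po 'X^p ->
  exists k e, (size h).-1 = (k * (size g).-1)%N /\
    g`_0 ^+ k = (-1) ^+ e * h`_0 ^+ p.
Proof.
move=> g_monic g_irr h_monic h_gt1 h_dvd.
(* Only the characteristic polynomial of [C] matters below, so the companion matrix is generalized;
   this also frees its dimension to be written as a successor. *)
have := companionmxK h_monic; move: (companionmx h).
case: (size h) h_gt1 => [|[|n]] //= _ C charC.
have gCp : horner_mx (C ^+ p) g = 0.
  rewrite -[C in C ^+ p]horner_mx_X -rmorphXn -horner_mx_comp.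
  by rewrite -(divpK h_dvd) rmorphM /= -[in X in _ * X]charC Cayley_Hamilton mulr0.
have [k charCp] := monic_dvdp_irredX g_monic g_irr (char_poly_monic _)
                     (char_poly_dvdX gCp).
(* One sign [(-1) ^+ n.+1] relates the constant term of [char_poly (C ^+ p)] to its determinant; the
   other relates [\det C] to [h(0)] and is raised to the power [p]. *)
exists k, (n.+1 + n.+1 * p)%N; split.
  have /(congr1 (fun q : {poly K} => (size q).-1)) := charCp.
  by rewrite size_char_poly size_exp mulnC.
have detC : \det C = (-1) ^+ n.+1 * h`_0.
  by rewrite -charC char_poly_det mulrA -exprMn mulrNN mulr1 expr1n mul1r.
have /(congr1 (fun q : {poly K} => q`_0)) := charCp.
rewrite char_poly_det det_exp detC exprMn -exprM mulrA -exprD => ->.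
by rewrite -!horner_coef0 horner_exp.
Qed.

(** Bezout: with [u k = v p + 1], one has [a = a^(u k) / a^(v p)], which is [(b^u / a^v)^p] up to
    sign. *)
Lemma signed_root_coprime (K : fieldType) (a b : K) (k p e : nat) :
  (0 < k)%N -> coprime k p -> a != 0 -> a ^+ k = (-1) ^+ e * b ^+ p ->
  exists e' y, a = (-1) ^+ e' * y ^+ p.
Proof.
move=> k_gt0 co_kp a_neq0 akE.
case: (egcdnP p k_gt0) => u v uvE _.
exists (e * u)%N, (b ^+ u / a ^+ v); move: uvE; rewrite (eqP co_kp) => uvE.
have apv_neq0 : a ^+ (v * p) != 0 by rewrite expf_neq0.
apply: (mulfI apv_neq0); rewrite -exprSr -addn1 -uvE mulnC exprM akE exprMn.
rewrite exprM -!exprM expr_div_n -!exprM mulrCA; congr (_ * _).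
by rewrite mulrC divfK // mulnC.
Qed.

Lemma irreducible_polyPn (K : fieldType) (q : {poly K}) :
  (1 < size q)%N -> ~ irreducible_poly q ->
  exists2 h, h \is monic & (1 < size h < size q)%N /\ h %| q.
Proof.
move=> q_gt1 q_red; apply: NNPP => no_factor; apply: q_red; split=> // r r_neq1.
move=> r_dvd_q; have q_neq0 : q != 0 by rewrite -size_poly_gt0 ltnW.
have r_neq0 : r != 0 by apply: contraNneq q_neq0 => r0; move: r_dvd_q; rewrite r0 dvd0p.
rewrite -(dvdp_size_eqp r_dvd_q) eqn_leq dvdp_leq //= leqNgt; apply/negP => r_lt.
have lc_neq0 : (lead_coef r)^-1 != 0 by rewrite invr_eq0 lead_coef_eq0.
apply: no_factor; exists ((lead_coef r)^-1 *: r).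
  by rewrite monicE lead_coefZ mulVf ?lead_coef_eq0.
rewrite size_scale // dvdpZl // r_lt andbT ltn_neqAle eq_sym r_neq1.
by rewrite size_poly_gt0.
Qed.

Lemma comp_Xprime_reducible (K : fieldType) (g : {poly K}) (p : nat) :
  prime p -> g \is monic -> irreducible_poly g ->
  ~ irreducible_poly (g \Po 'X^p) ->
  exists e y, g`_0 = (-1) ^+ e * y ^+ p.
Proof.
move=> p_pr g_monic g_irr gXp_red; have [g_gt1 _] := g_irr.
have p_gt0 := prime_gt0 p_pr.
have deg_gXp : (size (g \Po 'X^p)).-1 = ((size g).-1 * p)%N.
  by rewrite size_comp_poly size_polyXn.
have gXp_gt1 : (1 < size (g \Po 'X^p))%N.
  by rewrite -subn_gt0 subn1 deg_gXp muln_gt0 p_gt0 -subn1 subn_gt0 g_gt1.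
have [h h_monic [/andP[h_gt1 h_lt] h_dvd]] := irreducible_polyPn gXp_gt1 gXp_red.
have [k [e [deg_h g0E]]] := monic_dvdp_comp_Xn g_monic g_irr h_monic h_gt1 h_dvd.
(* The Bezout argument divides by a power of [g(0)], so the value zero is treated apart, as the
   [p]-th power of 0. *)
have [g0|g0_neq0] := eqVneq g`_0 0.
  by exists 0%N, 0; rewrite g0 expr0n eqn0Ngt p_gt0 mulr0.
have k_gt0 : (0 < k)%N.
  by move: h_gt1; rewrite -subn_gt0 subn1 deg_h muln_gt0 => /andP[].
apply: (signed_root_coprime k_gt0 _ g0_neq0 g0E).
(* It remains to see [k < p], which follows from [k deg g = deg h < p deg g]. *)
rewrite coprime_sym prime_coprime // gtnNdvd //.
have deg_g_gt0 : (0 < (size g).-1)%N by rewrite -subn1 subn_gt0.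
rewrite -(ltn_pmul2r deg_g_gt0) -deg_h mulnC -deg_gXp.
by case: (size h) (size (g \Po _)) h_gt1 h_lt => [|m] // [].
Qed.

Lemma comp_Xn_reducible (K : fieldType) (g : {poly K}) (d : nat) :
  (0 < d)%N -> g \is monic -> irreducible_poly g ->
  ~ irreducible_poly (g \Po 'X^d) ->
  exists p, [/\ prime p, (p %| d)%N & exists e y, g`_0 = (-1) ^+ e * y ^+ p].
Proof.
elim/ltn_ind: d g => d IHd g d_gt0 g_monic g_irr gXd_red.
have [d_gt1|] := ltnP 1 d; last first.
  case: d d_gt0 gXd_red {IHd} => [|[|d]] // _ [].
  by rewrite expr1 comp_polyXr.
have p_pr := pdiv_prime d_gt1; set p := pdiv d in p_pr.
have p_dvd : (p %| d)%N := pdiv_dvd d; have p_gt0 := prime_gt0 p_pr.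
(* If [g \Po 'X^p] is still irreducible, it takes the place of [g], and [d %/ p] that of [d]. *)
have [gXp_irr|gXp_red] := classic (irreducible_poly (g \Po 'X^p)); last first.
  by exists p; split=> //; apply: comp_Xprime_reducible.
have Xp_gt1 : (1 < size ('X^p : {poly K}))%N by rewrite size_polyXn.
have gXp_monic : g \Po 'X^p \is monic.
  by rewrite monicE lead_coef_comp // lead_coefXn expr1n mulr1 -monicE.
have [|||q [q_pr q_dvd g0E]] := IHd (d %/ p)%N _ (g \Po 'X^p) _ gXp_monic gXp_irr.
- by rewrite ltn_Pdiv // prime_gt1.
- by rewrite divn_gt0 // dvdn_leq.
- by rewrite -comp_polyA comp_Xn_poly -exprM divnK.
exists q; split=> //; first exact: dvdn_trans q_dvd (dvdn_div p_dvd).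
move: g0E; rewrite -!horner_coef0 horner_comp hornerXn.
by rewrite expr0n eqn0Ngt p_gt0.
Qed.

(** Translation by [c] is invertible and preserves degree, so divisors are carried back to [g] by
    translation by [- c]. *)
Lemma irredp_comp_XaddC (K : fieldType) (g : {poly K}) (c : K) :
  irreducible_poly g -> irreducible_poly (g \Po ('X + c%:P)).
Proof.
have shiftK (q : {poly K}) : (q \Po ('X - c%:P)) \Po ('X + c%:P) = q.
  by have := comp_polyXaddC_K q (- c); rewrite polyCN opprK.
move=> [g_gt1 g_irr]; split=> [|q q_neq1 q_dvd].
  by rewrite size_comp_poly2 ?size_XaddC.
have q'_dvd : q \Po ('X - c%:P) %| g.
  by rewrite -(comp_polyXaddC_K g c) dvdp_comp_poly.
have := g_irr _ _ q'_dvd; rewrite size_comp_poly2 ?size_XsubC // => /(_ q_neq1).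
case/andP=> /(dvdp_comp_poly ('X + c%:P)) dvd1 /(dvdp_comp_poly ('X + c%:P)) dvd2.
by rewrite shiftK in dvd1 dvd2; apply/andP.
Qed.

Theorem theorem5p1 (K : fieldType) (charK0 : [pchar K] =i pred0)
    (f g : {poly K}) (d : nat) (c : K)
    (d_ge2 : (2 <= d)%N) (f_def : f = 'X^d + c%:P)
    (g_monic : g \is monic) (g_irr : irreducible_poly g)
    (gf_red : ~ irreducible_poly (g \Po f)) :
  exists (e1 e2 : nat) (y : K) (m : nat),
    [/\ (e1 <= 1)%N, (e2 <= 1)%N, (2 <= m)%N, (m %| d)%N
      & g.[f.[0]] = (-1) ^+ e1 * 4 ^+ e2 * y ^+ m].
Proof.
have d_gt0 : (0 < d)%N by exact: ltnW.
have shift_monic : g \Po ('X + c%:P) \is monic.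
  by rewrite monicE lead_coef_comp ?size_XaddC // lead_coefXaddC expr1n mulr1 -monicE.
(* Here [g \Po f] is the shifted polynomial composed with ['X^d], and the constant term of the shift
   is [g(c) = g(f(0))]. *)
have [|m [m_pr m_dvd [e [y g0E]]]] :=
    comp_Xn_reducible d_gt0 shift_monic (irredp_comp_XaddC c g_irr).
  by rewrite -comp_polyA comp_polyD comp_polyX comp_polyC -f_def.
(* Only the parity of [e] affects the sign. *)
exists (odd e), 0%N, y, m; split=> //; [by case: odd | exact: prime_gt1 |].
rewrite expr0 mulr1 signr_odd -g0E -horner_coef0 horner_comp f_def.
by rewrite !hornerE expr0n eqn0Ngt d_gt0 add0r.
Qed.
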